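(* Let $\hat K\in\mathcal K$ satisfy $\nabla C(\hat K)=0$. Then $\hat K=\hat K^*$. That is, the only stationary point of $C$ on $\mathcal K$ is the global optimal solution $\hat K^*$ of the problem of minimizing $C$ over $\mathcal K$.
   Context: Setting. Consider the Markovian jump linear system $x_{t+1}=A_{\omega(t)}x_t+B_{\omega(t)}u_t$, $t=0,1,2,\dots$, with $x_t\in\mathbb R^d$, $u_t\in\mathbb R^k$, $A_i\in\mathbb R^{d\times d}$, $B_i\in\mathbb R^{d\times k}$ for $i\in\Omega=\{1,\dots,n_s\}$. Here $\omega(t)$ is a Markov chain on $\Omega$ with transition probabilities $p_{ij}=\mathbb P(\omega(t+1)=j\mid\omega(t)=i)$ and initial distribution $\rho=(\rho_1,\dots,\rho_{n_s})$. The initial state $x_0\sim\mathcal D$ has finite second moment and is independent of the chain. Let $Q_i\succ0$ ($d\times d$) and $R_i\succ0$ ($k\times k$) be symmetric. Standing assumptions: $\rho_i>0$ for all $i$ and $\mathbb E[x_0x_0^T]\succ0$. Policies. A policy is $\hat K=\begin{bmatrix}K_1&\cdots&K_{n_s}\end{bmatrix}$ with $K_i\in\mathbb R^{k\times d}$, acting by $u_t=-K_{\omega(t)}x_t$. $\mathcal K$ denotes the set of policies that stabilize the closed loop in the mean square sense, i.e. $\mathbb E[\|x_t\|^2]\to0$ for every initial state and every initial mode distribution. The cost is $$C(\hat K)=\mathbb E_{x_0\sim\mathcal D,\,\omega(0)\sim\rho}\Big[\sum_{t=0}^\infty x_t^TQ_{\omega(t)}x_t+u_t^TR_{\omega(t)}u_t\Big].$$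 It is finite and differentiable on $\mathcal K$, with gradient $\nabla C(\hat K)\in\mathbb R^{k\times dn_s}$ defined by $dC(\hat K)=\mathrm{tr}(d\hat K^T\nabla C(\hat K))$. Optimal policy. For a family $P=(P_j)_{j\in\Omega}$ put $\mathcal E_i(P)=\sum_{j=1}^{n_s}p_{ij}P_j$. $\hat K^*=[K_1^*\ \cdots\ K_{n_s}^*]$ is given by $K_i^*=(R_i+B_i^T\mathcal E_i(P)B_i)^{-1}B_i^T\mathcal E_i(P)A_i$, where $(P_i)_{i\in\Omega}$ is the unique positive definite solution of the coupled Riccati equations $P_i=Q_i+A_i^T\mathcal E_i(P)A_i-A_i^T\mathcal E_i(P)B_i(R_i+B_i^T\mathcal E_i(P)B_i)^{-1}B_i^T\mathcal E_i(P)A_i$, $i\in\Omega$. It is a known fact that $\hat K^*$ minimizes $C$ over $\mathcal K$. *)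

(* Defs.v *)
From HB Require Import structures.
From mathcomp Require Import all_boot all_order all_algebra.
From mathcomp Require Import all_classical all_reals all_analysis.

Set Implicit Arguments.
Unset Strict Implicit.
Unset Printing Implicit Defensive.

Import Order.TTheory GRing.Theory Num.Theory.
Import numFieldNormedType.Exports.

Local Open Scope classical_set_scope.
Local Open Scope ring_scope.

Definition qform (R : realType) (n : nat) (M : 'M[R]_n) (x : 'cV[R]_n) : R :=
  (x^T *m M *m x) 0 0.

(* The library norm on matrices is the sup norm, so the squared Euclidean norm
   is spelled out. *)
Definition sqnorm (R : realType) (n : nat) (x : 'cV[R]_n) : R :=
  \sum_(a < n) x a 0 ^+ 2.

Definition posdef (R : realType) (n : nat) (M : 'M[R]_n) : Prop :=
  M^T = M /\ forall x : 'cV[R]_n, x != 0 -> 0 < qform M x.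

Definition stochastic (R : realType) (ns : nat) (p : 'M[R]_ns) : Prop :=
  (forall i j, 0 <= p i j) /\ (forall i, \sum_(j < ns) p i j = 1).

(* The Markov property is in product form, so that conditioning on null events
   needs no convention. *)
Definition markov_chain (R : realType) (ns : nat) (p : 'M[R]_ns)
    (rho : 'I_ns -> R) (disp : measure_display) (Om : measurableType disp)
    (Pr : probability Om R) (omega : nat -> Om -> 'I_ns) : Prop :=
  [/\ forall t i, measurable (omega t @^-1` [set i]),
      forall i, Pr (omega 0%N @^-1` [set i]) = (rho i)%:E
    & forall (s : nat -> 'I_ns) (t : nat),
        Pr [set w | forall u, (u <= t.+1)%N -> omega u w = s u] =
        (Pr [set w | forall u, (u <= t)%N -> omega u w = s u]
         * (p (s t) (s t.+1))%:E)%E].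

Definition random_vector (R : realType) (d : nat) (disp : measure_display)
    (Om : measurableType disp) (x0 : Om -> 'cV[R]_d) : Prop :=
  forall a, measurable_fun setT (fun w => x0 w a 0).

Definition sigma_vector (R : realType) (d : nat) (Om : Type)
    (x0 : Om -> 'cV[R]_d) : set (set Om) :=
  <<s [set E | exists a (V : set R),
         measurable V /\ E = (fun w => x0 w a 0) @^-1` V] >>.

Definition sigma_chain (ns : nat) (Om : Type) (omega : nat -> Om -> 'I_ns) :
    set (set Om) :=
  <<s [set E | exists t i, E = omega t @^-1` [set i]] >>.

Definition independent_of_chain (R : realType) (d ns : nat)
    (disp : measure_display) (Om : measurableType disp) (Pr : probability Om R)
    (x0 : Om -> 'cV[R]_d) (omega : nat -> Om -> 'I_ns) : Prop :=
  forall E F, sigma_vector x0 E -> sigma_chain omega F ->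
    Pr (E `&` F) = (Pr E * Pr F)%E.

(* E[x0 x0^T]; [fine] is harmless when the second moment is finite. *)
Definition second_moment (R : realType) (d : nat) (disp : measure_display)
    (Om : measurableType disp) (Pr : probability Om R) (x0 : Om -> 'cV[R]_d) :
    'M[R]_d :=
  \matrix_(a, b) fine ('E_Pr[fun w => (x0 w a 0 * x0 w b 0)%R])%E.

(* k x (d ns) matrices seen as rows [K_1 ... K_ns] of ns blocks of size k x d. *)
Notation policy R ns d k := 'M[R]_(k, (\sum_(i < ns) d)%N).

Definition gain (R : realType) (ns d k : nat) (K : policy R ns d k)
    (i : 'I_ns) : 'M[R]_(k, d) :=
  @submxrow R ns (fun=> d) k K i.

(* dF(K)[H] = tr(H^T G): the gradient for the Frobenius inner product. *)
Definition is_gradient (R : realType) (m n : nat) (F : 'M[R]_(m, n) -> R)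
    (K G : 'M[R]_(m, n)) : Prop :=
  differentiable F K /\ forall H : 'M[R]_(m, n), 'd F K H = \tr (H^T *m G).

Section closed_loop.
Context (R : realType) (ns d k : nat).
Variables (A : 'I_ns -> 'M[R]_d) (B : 'I_ns -> 'M[R]_(d, k)).

Definition input (K : policy R ns d k) (i : 'I_ns) (x : 'cV[R]_d) : 'cV[R]_k :=
  - (gain K i *m x).

Fixpoint state (K : policy R ns d k) (s : nat -> 'I_ns) (x0 : 'cV[R]_d)
    (t : nat) : 'cV[R]_d :=
  if t is t'.+1 then
    let x := state K s x0 t' in A (s t') *m x + B (s t') *m input K (s t') x
  else x0.

Definition ms_stabilizing (p : 'M[R]_ns) (K : policy R ns d k) : Prop :=
  forall (x0 : 'cV[R]_d) (rho : 'I_ns -> R)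
    (disp : measure_display) (Om : measurableType disp) (Pr : probability Om R)
    (omega : nat -> Om -> 'I_ns),
    markov_chain p rho Pr omega ->
    (fun t => ('E_Pr[fun w => sqnorm (state K (omega ^~ w) x0 t)])%E) @ \oo --> 0%E.

Variables (Q : 'I_ns -> 'M[R]_d) (Rc : 'I_ns -> 'M[R]_k).

Definition stage_cost (K : policy R ns d k) (s : nat -> 'I_ns) (x0 : 'cV[R]_d)
    (t : nat) : R :=
  let x := state K s x0 t in
  qform (Q (s t)) x + qform (Rc (s t)) (input K (s t) x).

Definition ecost (disp : measure_display) (Om : measurableType disp)
    (Pr : probability Om R) (x0 : Om -> 'cV[R]_d) (omega : nat -> Om -> 'I_ns)
    (K : policy R ns d k) : \bar R :=
  (\int[Pr]_w \sum_(0 <= t <oo) (stage_cost K (omega ^~ w) (x0 w) t)%:E)%E.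

(* [ecost] is finite on stabilizing policies, where [cost] is thus its value. *)
Definition cost (disp : measure_display) (Om : measurableType disp)
    (Pr : probability Om R) (x0 : Om -> 'cV[R]_d) (omega : nat -> Om -> 'I_ns)
    (K : policy R ns d k) : R :=
  fine (ecost Pr x0 omega K).

Variable p : 'M[R]_ns.

Definition mode_mean (P : 'I_ns -> 'M[R]_d) (i : 'I_ns) : 'M[R]_d :=
  \sum_(j < ns) p i j *: P j.

Definition optimal_gain (P : 'I_ns -> 'M[R]_d) (i : 'I_ns) : 'M[R]_(k, d) :=
  invmx (Rc i + (B i)^T *m mode_mean P i *m B i)
    *m (B i)^T *m mode_mean P i *m A i.

Definition optimal_policy (P : 'I_ns -> 'M[R]_d) : policy R ns d k :=
  @mxrow R ns (fun=> d) k (optimal_gain P).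

Definition coupled_riccati (P : 'I_ns -> 'M[R]_d) : Prop :=
  forall i, P i = Q i + (A i)^T *m mode_mean P i *m A i
    - (A i)^T *m mode_mean P i *m B i
        *m invmx (Rc i + (B i)^T *m mode_mean P i *m B i)
        *m (B i)^T *m mode_mean P i *m A i.

End closed_loop.

(* Main.v *)
Require Import Defs.
From HB Require Import structures.
From mathcomp Require Import all_boot all_order all_algebra.
From mathcomp Require Import all_classical all_reals all_analysis.
From mathcomp Require Import measurable_realfun ring lra.
Import Order.TTheory GRing.Theory Num.Theory.
Import numFieldNormedType.Exports.
Local Open Scope classical_set_scope.
Local Open Scope ring_scope.

Set Implicit Arguments.
Unset Strict Implicit.
Unset Printing Implicit Defensive.

(** The cost-to-go of a stationary policy solves the coupled Riccati equations, which
    have only one positive definite solution.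

    Write [lyap p C D i] for the matrix of the quadratic form that maps [x] to the
    conditional expectation of [x_(t+1)^T D_(omega(t+1)) x_(t+1)] given
    [omega t = i] and [x_t = x], when [x_(t+1) = C_(omega t) x_t]. By the Markov
    property ([state_expectation]) the expected cost of stage [t] is linear in
    the [t]-th iterate of this operator applied to the stage-cost matrices, so
    that the cost becomes the limit of a deterministic value iteration. Mean
    square stability says that the iterates of the identity vanish
    ([stabilizing_vanishing]). Hence [1 - lyap p C] is injective on a
    finite-dimensional space, and the stabilizing policy [K] has a cost-to-go [V],
    the solution of a Lyapunov equation ([lyap_solution]).

    The gradient is tested along one ray. A nonnegative family [P] with
    [run_cost + lyap P + G <= P], where [G >= 0], bounds the cost of any policy from
    above by the mean value of [P - G] ([ecost_upper]).
    If the residual [F_i = (R_i + B_i^T E_i(V) B_i) K_i - B_i^T E_i(V) A_i] is not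
    zero, a step of length [eps] along [- F] satisfies this inequality with
    [P = V] and [G = eps F^T F] ([gradient_step]), so the cost drops at a rate that
    is positive because all modes have positive initial probability and the second
    moment of [x0] is positive definite. A zero gradient forbids this
    ([zero_gradient_rate]), hence [F = 0].

    Then [V] with [K] is a Bellman pair, as is the given Riccati solution with its
    gains ([riccati_bellman]). In a Bellman pair the gains are stabilizing, since
    the cost-to-go is a Lyapunov certificate ([bellman_vanishing]), and two such
    pairs dominate each other ([bellman_le]), so they coincide ([bellman_unique]).
    Optimality follows from the lower bound [ecost_lower], whose inequality every
    policy satisfies by completion of the square ([bellman_improve]). *)

(** * Quadratic forms *)

Section quadratic_forms.
Context (R : realType).

Definition bform n (M : 'M[R]_n) (x y : 'cV[R]_n) : R := (x^T *m M *m y) 0 0.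

Lemma bformE n (M : 'M[R]_n) x y :
  bform M x y = \sum_a \sum_b x a 0 * M a b * y b 0.
Proof.
rewrite /bform !mxE exchange_big/=; apply: eq_bigr => b _.
by rewrite !mxE mulr_suml; apply: eq_bigr => a _; rewrite mxE.
Qed.

Lemma bform_delta n (M : 'M[R]_n) a b :
  bform M (delta_mx a 0) (delta_mx b 0) = M a b.
Proof. by rewrite /bform trmx_delta -rowE -colE !mxE. Qed.

Lemma bformD n (M N : 'M[R]_n) x y : bform (M + N) x y = bform M x y + bform N x y.
Proof. by rewrite /bform mulmxDr mulmxDl mxE. Qed.

Lemma bformN n (M : 'M[R]_n) x y : bform (- M) x y = - bform M x y.
Proof. by rewrite /bform mulmxN mulNmx mxE. Qed.

Lemma bformZ n c (M : 'M[R]_n) x y : bform (c *: M) x y = c * bform M x y.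
Proof. by rewrite /bform -scalemxAr -scalemxAl mxE. Qed.

Lemma bform0 n x y : bform (0 : 'M[R]_n) x y = 0.
Proof. by rewrite /bform mulmx0 mul0mx mxE. Qed.

Lemma bform_sum n (I : finType) (M : I -> 'M[R]_n) x y :
  bform (\sum_i M i) x y = \sum_i bform (M i) x y.
Proof. by rewrite /bform mulmx_sumr mulmx_suml summxE. Qed.

Lemma bform_congr n m (C : 'M[R]_(n, m)) (M : 'M[R]_n) x y :
  bform (C^T *m M *m C) x y = bform M (C *m x) (C *m y).
Proof. by rewrite /bform trmx_mul !mulmxA. Qed.

Lemma qform_addZ n (M : 'M[R]_n) x y s : qform M (x + s *: y) =
  qform M x + s * (bform M x y + bform M y x) + s ^+ 2 * qform M y.
Proof.
have Dl x1 x2 z : bform M (x1 + s *: x2) z = bform M x1 z + s * bform M x2 z.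
  rewrite /bform [(_ + _)^T]linearD/= [(_ *: _)^T]linearZ/= !mulmxDl -!scalemxAl.
  by rewrite [LHS]mxE; congr (_ + _); rewrite [LHS]mxE.
have Dr x1 x2 z : bform M z (x1 + s *: x2) = bform M z x1 + s * bform M z x2.
  rewrite /bform mulmxDr -scalemxAr.
  by rewrite [LHS]mxE; congr (_ + _); rewrite [LHS]mxE.
by rewrite -[LHS]/(bform _ _ _) Dl !Dr /qform -!/(bform _ _ _); ring.
Qed.

Lemma qformD n (M N : 'M[R]_n) x : qform (M + N) x = qform M x + qform N x.
Proof. exact: bformD. Qed.

Lemma qformN n (M : 'M[R]_n) x : qform (- M) x = - qform M x.
Proof. exact: bformN. Qed.

Lemma qformB n (M N : 'M[R]_n) x : qform (M - N) x = qform M x - qform N x.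
Proof. by rewrite qformD qformN. Qed.

Lemma qformZ n c (M : 'M[R]_n) x : qform (c *: M) x = c * qform M x.
Proof. exact: bformZ. Qed.

Lemma qform0 n x : qform (0 : 'M[R]_n) x = 0.
Proof. exact: bform0. Qed.

Lemma qform_congr n m (C : 'M[R]_(n, m)) (M : 'M[R]_n) x :
  qform (C^T *m M *m C) x = qform M (C *m x).
Proof. exact: bform_congr. Qed.

Lemma qform1 n (x : 'cV[R]_n) : qform 1%:M x = sqnorm x.
Proof.
by rewrite /qform mulmx1 mxE; apply: eq_bigr => a _; rewrite mxE expr2.
Qed.

Lemma sqnorm_ge0 n (x : 'cV[R]_n) : 0 <= sqnorm x.
Proof. by apply: sumr_ge0 => a _; exact: sqr_ge0. Qed.

Lemma sqr_le_sqnorm n (x : 'cV[R]_n) a : x a 0 ^+ 2 <= sqnorm x.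
Proof.
by rewrite /sqnorm (bigD1 a)//= lerDl; apply: sumr_ge0 => b _; exact: sqr_ge0.
Qed.

Lemma qform_sym_eq n (M N : 'M[R]_n) : M^T = M -> N^T = N ->
  (forall x, qform M x = qform N x) -> M = N.
Proof.
move=> sM sN MN; apply/matrixP => a b.
pose D := M - N; have D0 x : qform D x = 0 by rewrite qformB MN subrr.
have sD : D b a = D a b.
  by rewrite !mxE -{1}sM -{1}sN !mxE.
suff : D a b = 0 by rewrite !mxE => /eqP; rewrite subr_eq0 => /eqP.
have := D0 (delta_mx a 0 + 1 *: delta_mx b 0); rewrite qform_addZ.
have := D0 (delta_mx a 0); have := D0 (delta_mx b 0).
rewrite /qform -/(bform _ _ _) => /[swap]; rewrite -/(bform _ _ _) => -> ->.
rewrite !bform_delta sD; lra.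
Qed.

Definition psd n (M : 'M[R]_n) : Prop := forall x, 0 <= qform M x.

Lemma posdef_psd n (M : 'M[R]_n) : posdef M -> psd M.
Proof.
move=> [_ M_gt0] x; have [->|/M_gt0/ltW//] := eqVneq x 0.
by rewrite /qform mulmx0 mxE.
Qed.

Lemma posdef_unit n (M : 'M[R]_n) : posdef M -> M \in unitmx.
Proof.
move=> [_ M_gt0]; rewrite -row_free_unit -kermx_eq0; apply/eqP/row_matrixP => i.
rewrite row0; set v := row i _.
have vM : v *m M = 0 by rewrite /v -row_mul mulmx_ker row0.
apply/eqP/negP => /negP v0.
have /M_gt0 : v^T != 0.
  by apply/eqP => /(congr1 trmx); rewrite trmxK trmx0; exact/eqP.
by rewrite /qform trmxK vM mul0mx mxE ltxx.
Qed.

(** With [w := M^-1 e_a] one has [e_a^T x = w^T M x], so that Cauchy-Schwarz for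
    the inner product [M] bounds each squared coordinate by a multiple of
    [qform M x]. *)
Lemma posdef_coercive n (M : 'M[R]_n) : posdef M ->
  exists2 c, 0 <= c & forall x, sqnorm x <= c * qform M x.
Proof.
move=> pM; have uM := posdef_unit pM; have [sM M_gt0] := pM.
pose w a : 'cV[R]_n := invmx M *m delta_mx a 0.
have Mw a : M *m w a = delta_mx a 0 by rewrite /w mulKVmx.
have wM a : (w a)^T *m M = delta_mx 0 a.
  by rewrite -{1}sM -trmx_mul Mw trmx_delta.
have qw a : qform M (w a) = w a a 0.
  by rewrite /qform wM -rowE !mxE.
have w_gt0 a : 0 < w a a 0.
  rewrite -qw; apply: M_gt0; apply/eqP => w0.
  have := Mw a; rewrite w0 mulmx0 => /matrixP/(_ a 0).
  by rewrite !mxE !eqxx => /eqP; rewrite eq_sym oner_eq0.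
exists (\sum_a w a a 0); first by apply: sumr_ge0 => a _; exact/ltW.
move=> x; rewrite mulr_suml; apply: ler_sum => a _.
have := posdef_psd pM (x - (x a 0 / w a a 0) *: w a).
set s := x a 0 / _.
rewrite -scaleNr qform_addZ qw.
have -> : bform M x (w a) = x a 0 by rewrite /bform -mulmxA Mw -colE !mxE.
have -> : bform M (w a) x = x a 0 by rewrite /bform wM -rowE !mxE.
have ws : w a a 0 * s = x a 0 by rewrite /s mulrC divfK// gt_eqF.
rewrite -!ws => h; rewrite -subr_ge0.
have := mulr_ge0 (ltW (w_gt0 a)) h; congr (0 <= _); ring.
Qed.

Lemma bform_bound n (M : 'M[R]_n) : exists2 c, 0 <= c &
  forall x y, `|bform M x y| <= c * (sqnorm x + sqnorm y).
Proof.
exists (\sum_a \sum_b `|M a b|).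
  by apply: sumr_ge0 => a _; apply: sumr_ge0 => b _.
move=> x y; rewrite bformE.
apply: (le_trans (ler_norm_sum _ _ _)); rewrite mulr_suml; apply: ler_sum => a _.
apply: (le_trans (ler_norm_sum _ _ _)); rewrite mulr_suml; apply: ler_sum => b _.
rewrite !normrM mulrAC mulrC; apply: ler_wpM2l => //.
have := sqr_le_sqnorm x a; have := sqr_le_sqnorm y b.
rewrite -(real_normK (num_real (x a 0))) -(real_normK (num_real (y b 0))).
have := sqr_ge0 (`|x a 0| - `|y b 0|).
have := sqr_ge0 (`|x a 0| + `|y b 0|).
nra.
Qed.

End quadratic_forms.

(** * Lyapunov operators of Markov jump systems *)

Section lyapunov.
Context (R : realType) (ns d : nat) (p : 'M[R]_ns).
Hypothesis hp : stochastic p.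
Implicit Types (C D M N P : 'I_ns -> 'M[R]_d) (i j : 'I_ns) (x y : 'cV[R]_d).

(** The adjoint of the recursion that the second moments [E[x_t x_t^T; omega t = i]]
    of [x_(t+1) = C_(omega t) x_t] obey. *)
Definition lyap C D i : 'M[R]_d := (C i)^T *m mode_mean p D i *m C i.

Definition qle D N : Prop := forall i x, qform (D i) x <= qform (N i) x.

Lemma bform_lyap C D i x y :
  bform (lyap C D i) x y = \sum_j p i j * bform (D j) (C i *m x) (C i *m y).
Proof.
by rewrite bform_congr bform_sum; apply: eq_bigr => j _; rewrite bformZ.
Qed.

Lemma qform_lyap C D i x :
  qform (lyap C D i) x = \sum_j p i j * qform (D j) (C i *m x).
Proof. exact: bform_lyap. Qed.

Lemma qle_trans D N M : qle D N -> qle N M -> qle D M.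
Proof. by move=> DN NM i x; apply: le_trans (DN i x) (NM i x). Qed.

Lemma lyap_mono C D N : qle D N -> qle (lyap C D) (lyap C N).
Proof.
move=> DN i x; rewrite !qform_lyap; apply: ler_sum => j _.
by apply: ler_wpM2l => //; exact: hp.1.
Qed.

Lemma lyap_psd C D : (forall i, psd (D i)) -> forall i, psd (lyap C D i).
Proof.
move=> D0 i x; rewrite qform_lyap; apply: sumr_ge0 => j _.
by apply: mulr_ge0; [exact: hp.1|exact: D0].
Qed.

Lemma iter_lyap_psd C D t : (forall i, psd (D i)) ->
  forall i, psd (iter t (lyap C) D i).
Proof. by move=> D0; elim: t => //= t IH; exact: lyap_psd. Qed.

Lemma lyapD C D N i : lyap C (fun j => D j + N j) i = lyap C D i + lyap C N i.
Proof.
rewrite /lyap /mode_mean -mulmxDl -mulmxDr -big_split/=.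
by congr (_ *m _ *m _); apply: eq_bigr => j _; rewrite scalerDr.
Qed.

Lemma lyapZ C c D i : lyap C (fun j => c *: D j) i = c *: lyap C D i.
Proof.
rewrite /lyap /mode_mean scalemxAl scalemxAr scaler_sumr.
by congr (_ *m _ *m _); apply: eq_bigr => j _; rewrite !scalerA mulrC.
Qed.

Lemma lyapB C D N i : lyap C (fun j => D j - N j) i = lyap C D i - lyap C N i.
Proof.
rewrite -scaleN1r -lyapZ -lyapD; congr lyap.
by apply/funext => j; rewrite scaleN1r.
Qed.

Lemma lyap_tr C D i : (lyap C D i)^T = lyap C (fun j => (D j)^T) i.
Proof.
rewrite /lyap /mode_mean !trmx_mul trmxK mulmxA; congr (_ *m _ *m _).
by rewrite linear_sum; apply: eq_bigr => j _; rewrite linearZ.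
Qed.

Fixpoint value_iter C M n : 'I_ns -> 'M[R]_d :=
  if n is m.+1 then fun i => M i + lyap C (value_iter C M m) i else fun=> 0.

Lemma value_iterS_iter C M n i :
  value_iter C M n.+1 i = value_iter C M n i + iter n (lyap C) M i.
Proof.
elim: n i => [|n IH] i.
  by rewrite /= add0r (_ : (fun=> 0) = (fun j => 0 *: (0 : 'M[R]_d)));
    [rewrite (lyapZ C 0 (fun=> 0)) scale0r addr0|apply/funext => j; rewrite scaler0].
transitivity (M i + lyap C (fun j => value_iter C M n j + iter n (lyap C) M j) i).
  by rewrite [LHS]/=; congr (_ + lyap C _ i); apply/funext => j; exact: IH.
by rewrite lyapD addrA.
Qed.

(** A supersolution bounds every stage of value iteration started at [0]; its
    slack [G] in the Lyapunov inequality is gained once, at the last backward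
    step. *)
Lemma value_iter_upper C M P G n : (forall i, psd (P i)) -> (forall i, psd (G i)) ->
  qle (fun i => M i + lyap C P i + G i) P ->
  qle (fun i => value_iter C M n.+1 i + G i) P.
Proof.
move=> P0 G0 MP.
have VP m : qle (value_iter C M m) P.
  elim: m => [|m IH] i x /=; first by rewrite qform0; exact: P0.
  apply: le_trans (MP i x); rewrite !qformD -addrA lerD2l.
  by rewrite (le_trans (lyap_mono C IH i x))// lerDl; exact: G0.
move=> i x /=; apply: le_trans (MP i x).
by rewrite !qformD lerD2r lerD2l; exact: lyap_mono.
Qed.

(** The final cost [P] after [n] steps makes [P] itself a lower bound of value
    iteration; for a vanishing operator
    the contribution of this final cost tends to zero. *)
Lemma value_iter_lower C M P n : qle P (fun i => M i + lyap C P i) ->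
  qle P (fun i => value_iter C M n i + iter n (lyap C) P i).
Proof.
move=> MP; elim: n => [|n IH] i x /=; first by rewrite add0r.
apply: le_trans (MP i x) _; rewrite !qformD -addrA lerD2l.
have := lyap_mono C IH i x.
by rewrite lyapD qformD.
Qed.

(** Mean square stability of [x_(t+1) = C_(omega t) x_t]: the iterate of the
    identity at [i] is the quadratic form [x |-> E |x_t|^2] of the state that
    starts at [x] in mode [i]. *)
Definition vanishing C : Prop := forall i x,
  (fun t => qform (iter t (lyap C) (fun=> 1%:M) i) x) @ \oo --> (0 : R).

Lemma lyap_dominated C D N c : 0 <= c ->
  (forall i x y, `|bform (D i) x y| <= c * (qform (N i) x + qform (N i) y)) ->
  forall i x y,
  `|bform (lyap C D i) x y| <= c * (qform (lyap C N i) x + qform (lyap C N i) y).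
Proof.
move=> c0 DN i x y; rewrite bform_lyap !qform_lyap -big_split/= mulr_sumr.
apply: (le_trans (ler_norm_sum _ _ _)); apply: ler_sum => j _.
rewrite normrM (ger0_norm (hp.1 i j)) -mulrDr mulrCA.
by apply: ler_wpM2l => //; exact: hp.1.
Qed.

(** Every bounded bilinear form is dominated by the identity, a domination that
    the operator preserves; for a form that is not symmetric this has to be
    said of pairs of vectors. *)
Lemma vanishing_bform C D i x y : vanishing C ->
  (fun t => bform (iter t (lyap C) D i) x y) @ \oo --> (0 : R).
Proof.
move=> vC.
have [c c0 Dc] : exists2 c, 0 <= c & forall i x y,
    `|bform (D i) x y| <= c * (qform (1%:M : 'M[R]_d) x + qform (1%:M : 'M[R]_d) y).
  have [f f0 fD] : exists2 f : 'I_ns -> R, (forall i, 0 <= f i) &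
      forall i x y, `|bform (D i) x y| <= f i * (sqnorm x + sqnorm y).
    have h j : {c : R | 0 <= c & forall x y, `|bform (D j) x y| <= c * (sqnorm x + sqnorm y)}.
      by apply: cid2; exact: bform_bound.
    by exists (fun j => s2val (h j)) => j; case: (h j).
  exists (\sum_j f j); first exact: sumr_ge0.
  move=> j u v; rewrite !qform1; apply: (le_trans (fD j u v)).
  apply: ler_wpM2r; first by rewrite addr_ge0// sqnorm_ge0.
  by rewrite (bigD1 j)//= lerDl sumr_ge0.
pose u t z := qform (iter t (lyap C) (fun=> 1%:M) i) z.
have le_u t : `|bform (iter t (lyap C) D i) x y| <= c * (u t x + u t y).
  rewrite /u; elim: t i x y {u} => [|t IH] j v w /=; first exact: Dc.
  exact: lyap_dominated.
have cu : (fun t => c * (u t x + u t y)) @ \oo --> (0 : R).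
  rewrite -[0 in X in _ --> X](mulr0 c) -[0 in X in _ --> X](addr0 0).
  by apply: cvgMl_tmp; apply: cvgD; exact: vC.
apply/norm_cvg0P; apply: squeeze_cvgr (cvg_cst 0) cu.
by apply: nearW => t; rewrite normr_ge0 le_u.
Qed.

Lemma vanishing_qform C D i x : vanishing C ->
  (fun t => qform (iter t (lyap C) D i) x) @ \oo --> (0 : R).
Proof. exact: vanishing_bform. Qed.

Lemma vanishing_coef C D i a b : vanishing C ->
  (fun t => iter t (lyap C) D i a b) @ \oo --> (0 : R).
Proof.
move=> vC; under eq_fun do rewrite -bform_delta.
exact: vanishing_bform.
Qed.

(** [D] dominates all its iterates, and these vanish. *)
Lemma lyap_comparison C D : vanishing C ->
  qle (lyap C D) D -> forall i, psd (D i).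
Proof.
move=> vC CD i x.
have le_iter t : qle (iter t (lyap C) D) D.
  elim: t => [|t IH] //=; apply: qle_trans CD.
  exact: lyap_mono.
apply: cvgr_to_le (vanishing_qform D i x vC) _.
by apply: nearW => t; exact: le_iter.
Qed.

(** A fixed point of the linear operator equals all its iterates, so it is zero;
    in finite dimension injectivity of [1 - lyap C] gives a solution. *)
Lemma lyap_solution C M : vanishing C -> (forall i, (M i)^T = M i) ->
  exists P, (forall i, P i = M i + lyap C P i) /\ (forall i, (P i)^T = P i).
Proof.
move=> vC sM.
have fix0 D : (forall i, D i = lyap C D i) -> forall i, D i = 0.
  move=> fD i; apply/matrixP => a b; rewrite [RHS]mxE.
  have it t : iter t (lyap C) D = D.
    by elim: t => //= t ->; apply/funext => j; rewrite -fD.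
  have /cvg_lim := vanishing_coef D i a b vC.
  under eq_fun do rewrite it.
  by rewrite lim_cst// => ->.
pose T (D : {ffun 'I_ns -> 'M[R]_d}) : {ffun 'I_ns -> 'M[R]_d} :=
  [ffun i => D i - lyap C D i].
have linT : linear T.
  move=> c D N; apply/ffunP => i; rewrite !ffunE.
  have -> : lyap C (c *: D + N)%R i = c *: lyap C D i + lyap C N i.
    by rewrite -lyapZ -lyapD; congr lyap; apply/funext => j; rewrite !ffunE.
  by rewrite scalerBr addrACA opprD.
pose Tl := GRing.isLinear.Build _ _ _ _ T linT.
pose TL : {linear _ -> _} := HB.pack T Tl.
have kerT : lker (linfun TL) == 0%VS.
  apply/lker0P => D N; rewrite !lfunE/= => /ffunP TDN.
  apply/ffunP => i; apply/eqP; rewrite -subr_eq0; apply/eqP.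
  apply: (fix0 (fun j => D j - N j)) => j; rewrite lyapB.
  have := TDN j; rewrite !ffunE => eDN.
  by apply/eqP; rewrite -subr_eq0 opprD addrACA -opprD eDN subrr.
pose P := ((linfun TL)^-1)%VF [ffun i => M i].
have fP i : P i = M i + lyap C P i.
  have := lker0_lfunVK kerT [ffun i => M i]; rewrite -/P lfunE/= => /ffunP/(_ i).
  by rewrite !ffunE => <-; rewrite subrK.
exists P; split => // i; apply/eqP; rewrite -subr_eq0; apply/eqP.
apply: (fix0 (fun j => (P j)^T - P j)) => j.
rewrite lyapB -lyap_tr {1 2}fP linearD/= sM.
by rewrite opprD addrACA subrr add0r.
Qed.

End lyapunov.

(** The partial sums of the nonnegative series [sum_t (lyap C)^t M] are at most
    [P], so its terms tend to zero, and they control the identity because [M]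
    does. *)
Lemma lyap_certificate (R : realType) (ns d : nat) (p : 'M[R]_ns)
    (C M P : 'I_ns -> 'M[R]_d) : stochastic p ->
  (forall i, posdef (M i)) -> (forall i, psd (P i)) ->
  (forall i, P i = M i + lyap p C P i) -> vanishing p C.
Proof.
move=> hp pM pP eP i x.
have M_psd j : psd (M j) by exact: posdef_psd.
pose u t := qform (iter t (lyap p C) M i) x.
have u_ge0 t : 0 <= u t by exact: (iter_lyap_psd hp C t M_psd i x).
have uE n : series u n = qform (value_iter p C M n i) x.
  elim: n => [|n IH]; first by rewrite /series/= big_geq// qform0.
  by rewrite value_iterS_iter qformD seriesSr -IH.
have u0 : u @ \oo --> (0 : R).
  apply: cvg_series_cvg_0; apply: nondecreasing_is_cvgn.
    by apply/nondecreasing_seqP => n; rewrite seriesSr lerDl.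
  exists (qform (P i) x) => _ [n _ <-]; rewrite uE.
  case: n => [|n]; first by rewrite qform0; exact: pP.
  have := @value_iter_upper R ns d p hp C M P (fun=> 0) n pP.
  move=> /(_ _ _ i x); rewrite addr0; apply => [j z|j z]; first by rewrite qform0.
  by rewrite addr0 -eP.
have [c c0 cM] : exists2 c, 0 <= c & forall j, forall y, sqnorm y <= c * qform (M j) y.
  have h j : {c : R | 0 <= c & forall y, sqnorm y <= c * qform (M j) y}.
    by apply: cid2; exact: posdef_coercive.
  exists (\sum_j s2val (h j)); first by apply: sumr_ge0 => j _; case: (h j).
  move=> j y; apply: (le_trans ((s2valP' (h j)) y)); apply: ler_wpM2r; first exact: M_psd.
  by rewrite (bigD1 j)//= lerDl; apply: sumr_ge0 => k _; case: (h k).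
have le1 t j y : qform (iter t (lyap p C) (fun=> 1%:M) j) y
    <= c * qform (iter t (lyap p C) M j) y.
  elim: t j y => [|t IH] j y /=; first by rewrite qform1.
  rewrite -qformZ -lyapZ; apply: lyap_mono => // k z.
  by rewrite qformZ.
have cu : (fun t => c * u t) @ \oo --> (0 : R).
  by rewrite -[0 in X in _ --> X](mulr0 c); exact: cvgMl_tmp.
apply: squeeze_cvgr (cvg_cst 0) cu.
apply: nearW => t; rewrite le1 andbT.
by apply: (@iter_lyap_psd _ _ _ _ hp) => j y; rewrite qform1 sqnorm_ge0.
Qed.

(** * Completion of the square and Bellman pairs *)

Section policies.
Context (R : realType) (ns d k : nat).
Context (A : 'I_ns -> 'M[R]_d) (B : 'I_ns -> 'M[R]_(d, k)).
Context (Q : 'I_ns -> 'M[R]_d) (Rc : 'I_ns -> 'M[R]_k) (p : 'M[R]_ns).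
Hypotheses (hQ : forall i, posdef (Q i)) (hR : forall i, posdef (Rc i)).
Hypothesis hp : stochastic p.
Implicit Types (L E : 'I_ns -> 'M[R]_(k, d)) (P : 'I_ns -> 'M[R]_d).

Definition loop L i : 'M[R]_d := A i - B i *m L i.

Definition run_cost L i : 'M[R]_d := Q i + (L i)^T *m Rc i *m L i.

Definition curvature P i : 'M[R]_k := Rc i + (B i)^T *m mode_mean p P i *m B i.

(** The first-order term of [complete_square]: when [P] is the cost-to-go of [L],
    the gradient of the cost at [L] is twice the residual times the accumulated
    second moments of the state. *)
Definition residual P L i : 'M[R]_(k, d) :=
  curvature P i *m L i - (B i)^T *m mode_mean p P i *m A i.

Lemma mode_mean_sym P i : (forall j, (P j)^T = P j) ->
  (mode_mean p P i)^T = mode_mean p P i.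
Proof.
move=> sP; rewrite /mode_mean linear_sum; apply: eq_bigr => j _.
by rewrite linearZ/= sP.
Qed.

Lemma mode_mean_psd P i : (forall j, psd (P j)) -> psd (mode_mean p P i).
Proof.
move=> P0 x; rewrite /qform -/(bform _ _ _) bform_sum; apply: sumr_ge0 => j _.
by rewrite bformZ; apply: mulr_ge0; [exact: hp.1|exact: P0].
Qed.

Lemma curvature_posdef P i : (forall j, (P j)^T = P j) -> (forall j, psd (P j)) ->
  posdef (curvature P i).
Proof.
move=> sP P0; split.
  by rewrite linearD/= (hR i).1 !trmx_mul trmxK mode_mean_sym// mulmxA.
move=> x x0; rewrite qformD qform_congr; apply: ltr_wpDr; last exact: (hR i).2.
exact: mode_mean_psd.
Qed.

Lemma run_cost_posdef L i : posdef (run_cost L i).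
Proof.
split.
  by rewrite linearD/= (hQ i).1 !trmx_mul trmxK (hR i).1 mulmxA.
move=> x x0; rewrite qformD qform_congr; apply: ltr_wpDr; last exact: (hQ i).2.
exact: posdef_psd.
Qed.

Lemma complete_square P L E i : (forall j, (P j)^T = P j) ->
  run_cost (fun j => L j + E j) i + lyap p (loop (fun j => L j + E j)) P i =
  run_cost L i + lyap p (loop L) P i
  + ((E i)^T *m residual P L i + (residual P L i)^T *m E i)
  + (E i)^T *m curvature P i *m E i.
Proof.
move=> sP; have sN := mode_mean_sym i sP; have sR := (hR i).1.
have -> : residual P L i = Rc i *m L i - (B i)^T *m mode_mean p P i *m loop L i.
  by rewrite /residual /curvature /loop mulmxBr opprB mulmxDl !mulmxA addrA.
rewrite /run_cost /lyap /curvature.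
have -> : loop (fun j => L j + E j) i = loop L i - B i *m E i.
  by rewrite /loop mulmxDr opprD addrA.
move: (loop L i) (mode_mean p P i) sN (Rc i) sR (B i) (L i) (E i) (Q i).
move=> c n sn r sr b l e q.
rewrite [(l + e)^T]linearD/= [(c - b *m e)^T]linearB/=.
rewrite [(r *m l - _)^T]linearB/= !trmx_mul sn sr trmxK.
rewrite !(mulmxDl, mulmxDr, mulNmx, mulmxN) !mulmxA ?opprK.
move: (l^T *m r *m l) (l^T *m r *m e) (e^T *m r *m l) (e^T *m r *m e).
move: (c^T *m n *m c) (c^T *m n *m b *m e) (e^T *m b^T *m n *m c).
move: (e^T *m b^T *m n *m b *m e) => *.
by apply/matrixP => ? ?; rewrite !mxE; ring.
Qed.

(** [P] is the cost-to-go of the gains [L], and [L] minimizes the one-step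
    look-ahead cost with respect to [P]. *)
Record bellman P L : Prop := Bellman {
  bellman_posdef : forall i, posdef (P i);
  bellman_fixed : forall i, P i = run_cost L i + lyap p (loop L) P i;
  bellman_greedy : forall i, residual P L i = 0 }.

(** The first-order term of the completed square vanishes and the second-order one
    is nonnegative. *)
Lemma bellman_improve P L L' : bellman P L ->
  qle P (fun i => run_cost L' i + lyap p (loop L') P i).
Proof.
move=> [pP fP gP] i x; have sP j := (pP j).1.
have -> : L' = fun j => L j + (L' j - L j) by apply/funext => j; rewrite subrKC.
rewrite complete_square// -fP gP mulmx0 trmx0 mul0mx !addr0 qformD qform_congr.
rewrite lerDl; apply: posdef_psd; apply: curvature_posdef => // j.
exact: posdef_psd.
Qed.

(** [P] is a subsolution of the Lyapunov equation that [P'] solves. *)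
Lemma bellman_le P L P' L' : bellman P L -> bellman P' L' ->
  vanishing p (loop L') -> qle P P'.
Proof.
move=> bP bP' vL' i x; rewrite -subr_ge0 -qformB.
apply: (lyap_comparison hp (D := fun j => P' j - P j) vL') => j y.
rewrite lyapB !qformB lerBrDr -lerBrDl opprB.
have := bellman_improve L' bP j y; rewrite (bellman_fixed bP' j) !qformD; lra.
Qed.

Lemma bellman_vanishing P L : bellman P L -> vanishing p (loop L).
Proof.
move=> [pP fP _]; apply: (lyap_certificate hp _ _ fP).
  exact: run_cost_posdef.
by move=> i; exact: posdef_psd.
Qed.

Lemma bellman_gain P L : bellman P L -> L = optimal_gain A B Rc p P.
Proof.
move=> [pP _ gP]; apply/funext => i; rewrite /optimal_gain -/(curvature P i).
have uS : curvature P i \in unitmx.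
  by apply/posdef_unit/curvature_posdef => j; [exact: (pP j).1|exact: posdef_psd].
by rewrite -!mulmxA [X in _ *m X]mulmxA -(subr0_eq (gP i)) mulKmx.
Qed.

Lemma bellman_unique P L P' L' : bellman P L -> bellman P' L' -> L = L'.
Proof.
move=> bP bP'; rewrite (bellman_gain bP) (bellman_gain bP'); congr optimal_gain.
apply/funext => i; apply: qform_sym_eq.
- exact: (bellman_posdef bP i).1.
- exact: (bellman_posdef bP' i).1.
- move=> x; apply/eqP; rewrite eq_le.
  rewrite (bellman_le bP bP' (bellman_vanishing bP')).
  by rewrite (bellman_le bP' bP (bellman_vanishing bP)).
Qed.

Lemma riccati_bellman P : (forall i, posdef (P i)) ->
  coupled_riccati A B Q Rc p P -> bellman P (optimal_gain A B Rc p P).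
Proof.
move=> pP ricP.
have sP j := (pP j).1.
have sN i := mode_mean_sym i sP.
have pS i : posdef (curvature P i).
  by apply: curvature_posdef => // j; exact: posdef_psd.
have SL i : curvature P i *m optimal_gain A B Rc p P i =
    (B i)^T *m mode_mean p P i *m A i.
  rewrite /optimal_gain -/(curvature P i) -!mulmxA mulKVmx//.
  exact: posdef_unit.
have gL i : residual P (optimal_gain A B Rc p P) i = 0 by rewrite /residual SL subrr.
split => // i.
move: (SL i) (gL i); set L := optimal_gain A B Rc p P => {}SL {}gL.
(* Compare with the zero gains, for which the right-hand side is Q + A^T N A. *)
have := complete_square L (fun j => - L j) i sP.
rewrite gL mulmx0 trmx0 mul0mx !addr0 /= => sq.
have -> : run_cost L i + lyap p (loop L) P i =
    Q i + (A i)^T *m mode_mean p P i *m A i - (L i)^T *m curvature P i *m L i.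
  apply/eqP; rewrite eq_sym subr_eq; apply/eqP.
  move: sq; rewrite [(- L i)^T]linearN/= mulNmx mulmxN mulNmx opprK => <-.
  by rewrite /run_cost /lyap /loop subrr trmx0 mul0mx mulmx0 mulmx0 !(addr0, subr0).
have -> : (L i)^T *m curvature P i *m L i =
    (A i)^T *m mode_mean p P i *m B i *m L i.
  have sS : (curvature P i)^T = curvature P i := (pS i).1.
  by rewrite -{1}sS -trmx_mul SL !trmx_mul trmxK sN mulmxA.
by rewrite {1}ricP /L /optimal_gain !mulmxA.
Qed.

(** A small gradient step decreases the one-step cost-to-go, the curvature term
    being of second order in [eps]. *)
Lemma gradient_step P L : (forall i, (P i)^T = P i) ->
  (forall i, P i = run_cost L i + lyap p (loop L) P i) ->
  exists2 e0 : R, 0 < e0 & forall eps, 0 < eps <= e0 ->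
    let L' j := L j + - eps *: residual P L j in
    qle (fun i => run_cost L' i + lyap p (loop L') P i
                  + eps *: ((residual P L i)^T *m residual P L i)) P.
Proof.
move=> sP fP.
have [c c0 Sc] : exists2 c : R, 0 <= c & forall i y, qform (curvature P i) y <= c * sqnorm y.
  have h j : {c : R | 0 <= c & forall x y,
      `|bform (curvature P j) x y| <= c * (sqnorm x + sqnorm y)}.
    by apply: cid2; exact: bform_bound.
  exists (2 * \sum_j s2val (h j)).
    by rewrite mulr_ge0//; apply: sumr_ge0 => j _; case: (h j).
  move=> j y; rewrite -mulrA mulrCA.
  apply: le_trans (_ : s2val (h j) * (2 * sqnorm y) <= _); last first.
    apply: ler_wpM2r; first by rewrite mulr_ge0// sqnorm_ge0.
    by rewrite (bigD1 j)//= lerDl; apply: sumr_ge0 => l _; case: (h l).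
  rewrite mulr_natl mulr2n; apply: le_trans (s2valP' (h j) y y).
  exact: ler_norm.
have c1 : 0 < c + 1 by rewrite ltr_wpDl.
exists (c + 1)^-1; first by rewrite invr_gt0.
move=> eps /andP[eps0 eps1] L' i x.
set F := residual P L in L' *.
rewrite complete_square// -fP -/F !qformD.
set y := F i *m x.
have FF : qform ((F i)^T *m F i) x = sqnorm y.
  by rewrite -qform1 -qform_congr mulmx1.
have -> : qform ((- eps *: F i)^T *m F i) x = - eps * sqnorm y.
  by rewrite [(_ *: _)^T]linearZ/= -scalemxAl qformZ FF.
have -> : qform ((F i)^T *m (- eps *: F i)) x = - eps * sqnorm y.
  by rewrite -scalemxAr qformZ FF.
have -> : qform ((- eps *: F i)^T *m curvature P i *m (- eps *: F i)) x =
    eps ^+ 2 * qform (curvature P i) y.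
  rewrite [(_ *: _)^T]linearZ/= -!scalemxAl -scalemxAr scalerA qformZ qform_congr.
  by rewrite mulrNN expr2.
rewrite qformZ FF.
have := Sc i y; have := sqnorm_ge0 y.
have : eps * c <= 1.
  have := ler_wpM2l (ltW c1) eps1; rewrite mulfV ?gt_eqF//; nra.
move: (sqnorm y) (qform _ y) => u v h1 h2 h3.
have : eps ^+ 2 * v <= eps * u.
  rewrite expr2 -mulrA ler_pM2l//.
  apply: le_trans (_ : eps * (c * u) <= _); first by rewrite ler_pM2l.
  by rewrite mulrA -[leRHS]mul1r ler_wpM2r.
lra.
Qed.

End policies.

(** * Independence and second moments *)

Section expectations.
Context (R : realType) (ns d : nat) (disp : measure_display).
Context (Om : measurableType disp) (Pr : probability Om R).

(** The function that equals [f] on [F] and [-1] elsewhere has, on the nonnegative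
    half-line, the distribution of [f] scaled by [Pr F]; hence the product rule
    for events suffices. *)
Lemma indep_ge0_integral (F : set Om) (f : Om -> R) : measurable F ->
  measurable_fun setT f -> (forall w, 0 <= f w) ->
  (forall V, measurable V -> Pr (f @^-1` V `&` F) = (Pr (f @^-1` V) * Pr F)%E) ->
  (\int[Pr]_(w in F) (f w)%:E = Pr F * \int[Pr]_w (f w)%:E)%E.
Proof.
move=> mF mf f0 indep.
pose phi w := (f w + 1) * \1_F w - 1.
have phiF w : F w -> phi w = f w.
  by move=> Fw; rewrite /phi indicE mem_set// mulr1 addrK.
have phiNF w : ~ F w -> phi w = -1.
  by move=> Fw; rewrite /phi indicE memNset// mulr0 sub0r.
have mphi : measurable_fun setT phi.
  apply: measurable_funD => //; apply: measurable_funM; last exact: measurable_indic.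
  exact: measurable_funD.
pose D : set R := `[0, +oo[%classic.
have mD : measurable D by exact: measurable_itv.
have mE : measurable_fun D (@EFin R).
  by apply/measurable_EFinP; exact: measurable_id.
have E0 : {in D, forall y, (0 <= y%:E)%E}.
  by move=> y; rewrite inE /D/= in_itv/= andbT lee_fin.
have phiD : phi @^-1` D = F.
  apply/seteqP; split => w; rewrite /D/= in_itv/= andbT.
    by apply: contraPP => /phiNF ->; rewrite ler0N1.
  by move=> /phiF ->.
have fD : f @^-1` D = setT.
  by apply/seteqP; split => w //= _; rewrite /D/= in_itv/= andbT.
pose c : {nonneg R} := NngNum (fine_ge0 (measure_ge0 Pr F)).
have cF : (c%:num)%:E = Pr F by rewrite fineK// fin_num_measure.
have := ge0_integral_pushforward mphi Pr mD mE E0; rewrite phiD.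
have := ge0_integral_pushforward mf Pr mD mE E0; rewrite fD => <-.
have -> : (\int[Pr]_(w in F) (EFin \o phi) w = \int[Pr]_(w in F) (f w)%:E)%E.
  by apply: eq_integral => w; rewrite inE /= => /phiF ->.
move=> <-; rewrite -cF -ge0_integral_mscale//; last first.
  by move=> y Dy; apply: E0; rewrite inE.
apply: eq_measure_integral => A mA AD.
rewrite -[RHS]/((c%:num)%:E * Pr (f @^-1` A))%E cF muleC -indep//; congr (Pr _).
apply/seteqP; split => w /=.
  move=> Aw; have Fw : F w by rewrite -phiD; exact: AD.
  by split => //; rewrite -phiF.
by move=> [Aw Fw]; rewrite phiF.
Qed.

Lemma measurable_qform (d0 : measure_display) (T : measurableType d0)
  (M : T -> 'M[R]_d) (x : T -> 'cV[R]_d) :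
  (forall a b, measurable_fun setT (fun w => M w a b)) ->
  (forall a, measurable_fun setT (fun w => x w a 0)) ->
  measurable_fun setT (fun w => qform (M w) (x w)).
Proof.
move=> mM mx; under eq_fun do rewrite -[qform _ _]/(bform _ _ _) bformE.
apply: measurable_sum => a; apply: measurable_sum => b.
by apply: measurable_funM => //; exact: measurable_funM.
Qed.

Lemma qform_indep (x0 : Om -> 'cV[R]_d) (F : set Om) (N : 'M[R]_d) :
  random_vector x0 -> measurable F -> psd N ->
  (forall E, sigma_vector x0 E -> Pr (E `&` F) = (Pr E * Pr F)%E) ->
  (\int[Pr]_(w in F) (qform N (x0 w))%:E
   = Pr F * \int[Pr]_w (qform N (x0 w))%:E)%E.
Proof.
move=> mx0 mF N0 indep; apply: indep_ge0_integral => //.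
- exact: measurable_qform.
- move=> V mV; apply: indep.
  (* Measurability for the sigma-algebra generated by x0 puts the preimage of V
     among the events that are independent of F. *)
  pose G := [set E | exists a (V : set R),
         measurable V /\ E = (fun w => x0 w a 0) @^-1` V].
  have mG a : measurable_fun setT
      (fun w : g_sigma_algebraType G => x0 w a 0 : R).
    move=> _ W mW; rewrite setTI; apply: sub_sigma_algebra.
    by exists a, W.
  have := @measurable_qform _ (g_sigma_algebraType G) (fun=> N) x0.
  move=> /(_ _ mG measurableT V mV); rewrite setTI; apply.
  by move=> a b; exact: measurable_cst.
Qed.

(** Products of coordinates are integrable, as they are dominated by the squared
    norm. *)
Lemma integral_qform (x0 : Om -> 'cV[R]_d) (N : 'M[R]_d) :
  random_vector x0 -> ('E_Pr[fun w => sqnorm (x0 w)] < +oo)%E ->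
  (\int[Pr]_w (qform N (x0 w))%:E = (\tr (N *m second_moment Pr x0))%:E)%E.
Proof.
move=> mx0; rewrite unlock => fin.
have ms : measurable_fun setT (fun w => sqnorm (x0 w)).
  by apply: measurable_sum => a; exact: measurable_funX.
have int_s : Pr.-integrable setT (EFin \o fun w => sqnorm (x0 w)).
  apply/integrableP; split; first exact/measurable_EFinP.
  by under eq_integral do rewrite gee0_abs ?lee_fin ?sqnorm_ge0//.
have iab a b : Pr.-integrable setT (fun w => (x0 w a 0 * x0 w b 0)%:E).
  apply: (le_integrable _ _ _ int_s) => //.
    by apply/measurable_EFinP; exact: measurable_funM.
  move=> w _; rewrite /= lee_fin normrM (ger0_norm (sqnorm_ge0 _)).
  have := sqr_le_sqnorm (x0 w) a; have := sqr_le_sqnorm (x0 w) b.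
  rewrite -(real_normK (num_real (x0 w a 0))) -(real_normK (num_real (x0 w b 0))).
  have := sqr_ge0 (`|x0 w a 0| - `|x0 w b 0|).
  have := sqr_ge0 (`|x0 w a 0| + `|x0 w b 0|).
  nra.
under eq_integral => w _.
  rewrite -[qform _ _]/(bform _ _ _) bformE -sumEFin.
  under eq_bigr => a _.
    rewrite -sumEFin.
    under eq_bigr => b _ do rewrite mulrAC mulrC EFinM.
    over.
  over.
rewrite /= integral_sum//; last first.
  by move=> a; apply: integrable_sum => // b _; exact: integrableZl.
rewrite /mxtrace -sumEFin; apply: eq_bigr => a _.
rewrite integral_sum//; last by move=> b; exact: integrableZl.
rewrite mxE -sumEFin; apply: eq_bigr => b _.
rewrite integralZl// EFinM; congr (_ * _)%E.
rewrite mxE fineK; last first.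
  by rewrite unlock; apply: integrable_fin_num => //.
by rewrite unlock; apply: eq_integral => w _; rewrite mulrC.
Qed.

End expectations.

(** * Quadratic functions of the state along the chain *)

Section markov.
Context (R : realType) (ns d : nat) (p : 'M[R]_ns) (rho : 'I_ns -> R).
Context (disp : measure_display) (Om : measurableType disp) (Pr : probability Om R).
Context (omega : nat -> Om -> 'I_ns).
Hypotheses (hp : stochastic p) (homega : markov_chain p rho Pr omega).
Implicit Types (C M : 'I_ns -> 'M[R]_d) (s : nat -> 'I_ns) (i j : 'I_ns).

Fixpoint transition C s t : 'M[R]_d :=
  if t is u.+1 then C (s u) *m transition C s u else 1%:M.

Lemma eq_transition C s s' t : (forall u, (u < t)%N -> s u = s' u) ->
  transition C s t = transition C s' t.
Proof.
elim: t => //= t IH ss'; rewrite ss'// IH// => u ut.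
by apply: ss'; exact: ltnW.
Qed.

Definition cylinder s t : set Om := [set w | forall u, (u <= t)%N -> omega u w = s u].

Definition extend s t j u : 'I_ns := if u == t.+1 then j else s u.

Lemma extend_le s t j u : (u <= t)%N -> extend s t j u = s u.
Proof. by rewrite /extend; case: eqP => // -> /[!ltnn]. Qed.

Lemma extend_last s t j : extend s t j t.+1 = j.
Proof. by rewrite /extend eqxx. Qed.

Lemma cylinder_extend s t j :
  cylinder (extend s t j) t.+1 = cylinder s t `&` omega t.+1 @^-1` [set j].
Proof.
apply/seteqP; split => w /=.
  move=> sw; split; last by rewrite sw// extend_last.
  by move=> u ut; rewrite sw ?extend_le// ltnW.
move=> [sw wj] u; rewrite leq_eqVlt => /predU1P[->|]; first by rewrite extend_last.
by rewrite ltnS => ut; rewrite extend_le// sw.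
Qed.

Lemma cylinder0 i : cylinder (fun=> i) 0 = omega 0 @^-1` [set i].
Proof.
apply/seteqP; split => w /=; first exact.
by move=> wi u; rewrite leqn0 => /eqP ->.
Qed.

Lemma cylinder_sigma_chain s t : sigma_chain omega (cylinder s t).
Proof.
have gen u i : sigma_chain omega (omega u @^-1` [set i]).
  by apply: sub_sigma_algebra; exists u, i.
elim: t => [|t IH].
  have -> : cylinder s 0 = omega 0 @^-1` [set s 0%N].
    apply/seteqP; split => w /=; first exact.
    by move=> wi u; rewrite leqn0 => /eqP ->.
  exact: gen.
have -> : cylinder s t.+1 = cylinder s t `&` omega t.+1 @^-1` [set s t.+1].
  rewrite -cylinder_extend; congr (cylinder _ _); apply/funext => u.
  by rewrite /extend; case: eqP => [->|].
pose G := [set E | exists t i, E = omega t @^-1` [set i]].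
exact: (@measurableI _ (g_sigma_algebraType G) _ _ IH (gen t.+1 (s t.+1))).
Qed.

Lemma sigma_chain_measurable : sigma_chain omega `<=` measurable.
Proof.
apply: smallest_sub; first exact: sigma_algebra_measurable.
by move=> _ [t [i ->]]; case: homega.
Qed.

Lemma measurable_cylinder s t : measurable (cylinder s t).
Proof. by apply: sigma_chain_measurable; exact: cylinder_sigma_chain. Qed.

Lemma measurable_mode (g : 'I_ns -> R) t :
  measurable_fun setT (fun w => g (omega t w)).
Proof.
have -> : (fun w => g (omega t w)) =
    (fun w => \sum_i g i * \1_(omega t @^-1` [set i]) w).
  apply/funext => w; rewrite (bigD1 (omega t w))//= big1 => [|i iw].
    by rewrite indicE mem_set// mulr1 addr0.
  rewrite indicE memNset ?mulr0//= => wi.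
  by rewrite wi eqxx in iw.
apply: measurable_sum => i; apply: measurable_funM => //.
by apply: measurable_indic; case: homega.
Qed.

Lemma measurable_state C t a b :
  measurable_fun setT (fun w => transition C (omega ^~ w) t a b).
Proof.
elim: t a b => [|t IH] a b /=; first by [].
under eq_fun do rewrite mxE.
apply: measurable_sum => l; apply: measurable_funM => //.
exact: (measurable_mode (fun i => C i a l)).
Qed.

Lemma measurable_qform_state C M (x0 : Om -> 'cV[R]_d) t : random_vector x0 ->
  measurable_fun setT (fun w => qform (M (omega t w))
    (transition C (omega ^~ w) t *m x0 w)).
Proof.
move=> mx0; apply: measurable_qform => [a b|a].
  exact: (measurable_mode (fun i => M i a b)).
under eq_fun do rewrite mxE.
apply: measurable_sum => l; apply: measurable_funM => //.
exact: measurable_state.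
Qed.

Lemma integral_partition (F : set Om) t (f : Om -> R) : measurable F ->
  measurable_fun setT f -> (forall w, 0 <= f w) ->
  (\int[Pr]_(w in F) (f w)%:E =
   \sum_j \int[Pr]_(w in F `&` omega t @^-1` [set j]) (f w)%:E)%E.
Proof.
move=> mF mf f0.
have m j : measurable (F `&` omega t @^-1` [set j]).
  by apply: measurableI => //; case: homega.
have U : F = \big[setU/set0]_j (F `&` omega t @^-1` [set j]).
  rewrite -bigcup_seq; apply/seteqP; split => [w Fw|w [j _ []//]].
  by exists (omega t w) => //=; rewrite mem_index_enum.
rewrite {1}U ge0_integral_bigsetU//.
- exact: index_enum_uniq.
- by move=> i j _ _ [w [[_ <-] [_ <-]]].
- by apply: measurable_funTS; exact/measurable_EFinP.
- by move=> w _; rewrite lee_fin.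
Qed.

(** Quadratic functions of [x0] see the chain only through probabilities; this
    form of independence covers both a
    random vector independent of the chain and a constant. *)
Definition decoupled (x0 : Om -> 'cV[R]_d) (S : 'M[R]_d) : Prop :=
  forall (N : 'M[R]_d) F, psd N -> sigma_chain omega F ->
  (\int[Pr]_(w in F) (qform N (x0 w))%:E = Pr F * (\tr (N *m S))%:E)%E.

(** Markov property for quadratic functions, by induction on the horizon [n] with
    the conditioning cylinder as a parameter; a cylinder is split according to its
    next mode. *)
Lemma cylinder_expectation C M (x0 : Om -> 'cV[R]_d) S n s t : random_vector x0 ->
  decoupled x0 S -> (forall i, psd (M i)) ->
  (\int[Pr]_(w in cylinder s t) (qform (M (omega (t + n)%N w))
      (transition C (omega ^~ w) (t + n) *m x0 w))%:E
   = Pr (cylinder s t) * (\tr ((transition C s t)^T *m iter n (lyap p C) M (s t)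
                           *m transition C s t *m S))%:E)%E.
Proof.
move=> mx0 dx0 M0; elim: n s t => [|n IH] s t.
  rewrite addn0 -dx0; last exact: cylinder_sigma_chain.
    apply: eq_integral => w; rewrite inE => sw.
    by rewrite sw// qform_congr (@eq_transition _ _ s)// => u /ltnW; exact: sw.
  by move=> x; rewrite qform_congr; exact: M0.
rewrite addnS -addSn (integral_partition t.+1)//; first last.
- by move=> w; exact: M0.
- exact: measurable_qform_state.
- exact: measurable_cylinder.
under eq_bigr => j _.
  rewrite -cylinder_extend IH extend_last.
  have -> : Pr (cylinder (extend s t j) t.+1) = (Pr (cylinder s t) * (p (s t) j)%:E)%E.
    have [_ _ /(_ (extend s t j) t)] := homega.
    rewrite -/(cylinder _ t.+1) -/(cylinder _ t) extend_last extend_le// => ->.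
    congr (Pr _ * _)%E; apply/seteqP; split => w sw u ut.
      by rewrite sw ?extend_le.
    by rewrite sw ?extend_le.
  have -> : transition C (extend s t j) t.+1 = C (s t) *m transition C s t.
    rewrite /= extend_le//; congr (_ *m _).
    by apply: eq_transition => u /ltnW; exact: extend_le.
  rewrite -(fineK (fin_num_measure Pr _ (measurable_cylinder s t))) -!EFinM -mulrA.
  over.
rewrite /= -(fineK (fin_num_measure Pr _ (measurable_cylinder s t))) -EFinM sumEFin.
congr (_%:E); rewrite -mulr_sumr; congr (_ * _).
rewrite /lyap /mode_mean -!mulmxA !mulmx_suml !mulmx_sumr raddf_sum /=.
apply: eq_bigr => j _.
by rewrite trmx_mul -!scalemxAl -!scalemxAr mxtraceZ !mulmxA.
Qed.

Lemma state_expectation C M (x0 : Om -> 'cV[R]_d) S n : random_vector x0 ->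
  decoupled x0 S -> (forall i, psd (M i)) ->
  (\int[Pr]_w (qform (M (omega n w)) (transition C (omega ^~ w) n *m x0 w))%:E
   = (\sum_i rho i * \tr (iter n (lyap p C) M i *m S))%:E)%E.
Proof.
move=> mx0 dx0 M0; rewrite (integral_partition 0)//; first last.
- by move=> w; exact: M0.
- exact: measurable_qform_state.
rewrite -sumEFin; apply: eq_bigr => i _; rewrite setTI -cylinder0.
have [_ rhoE _] := homega.
have := cylinder_expectation C n (fun=> i) 0 mx0 dx0 M0.
by rewrite add0n => ->; rewrite cylinder0 rhoE EFinM /= trmx1 mulmx1 mul1mx.
Qed.

Lemma decoupled_cst (x : 'cV[R]_d) : decoupled (fun=> x) (x *m x^T).
Proof.
move=> N F N0 /sigma_chain_measurable mF.
rewrite integral_cst// muleC mulmxA mxtrace_mulC mulmxA.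
by rewrite /mxtrace big_ord1.
Qed.

Lemma decoupled_independent (x0 : Om -> 'cV[R]_d) : random_vector x0 ->
  ('E_Pr[fun w => sqnorm (x0 w)] < +oo)%E -> independent_of_chain Pr x0 omega ->
  decoupled x0 (second_moment Pr x0).
Proof.
move=> mx0 fin indep N F N0 sF; rewrite -integral_qform//.
apply: qform_indep => //; first exact: sigma_chain_measurable.
by move=> E sE; exact: indep.
Qed.
End markov.

(** * Cost as a value iteration *)

Lemma cvg_sumr (R : realType) (I : finType) (f : I -> nat -> R) (l : I -> R) :
  (forall i, f i @ \oo --> l i) -> (fun t => \sum_i f i t) @ \oo --> \sum_i l i.
Proof.
move=> fl; elim: (index_enum I) => [|i r IH].
  rewrite big_nil; under eq_fun do rewrite big_nil; exact: cvg_cst.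
by rewrite big_cons; under eq_fun do rewrite big_cons; exact: cvgD.
Qed.

Section cost.
Context (R : realType) (ns d k : nat).
Context (A : 'I_ns -> 'M[R]_d) (B : 'I_ns -> 'M[R]_(d, k)).
Context (Q : 'I_ns -> 'M[R]_d) (Rc : 'I_ns -> 'M[R]_k).
Hypotheses (hQ : forall i, posdef (Q i)) (hR : forall i, posdef (Rc i)).
Context (p : 'M[R]_ns) (rho : 'I_ns -> R).
Hypotheses (hp : stochastic p) (hrho : forall i, 0 < rho i).
Context (disp : measure_display) (Om : measurableType disp) (Pr : probability Om R).
Context (omega : nat -> Om -> 'I_ns) (homega : markov_chain p rho Pr omega).
Implicit Types (K : policy R ns d k) (D N P G : 'I_ns -> 'M[R]_d).

Lemma state_transition K s (x : 'cV[R]_d) t :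
  state A B K s x t = transition (loop A B (gain K)) s t *m x.
Proof.
elim: t => [|t IH] /=; first by rewrite mul1mx.
by rewrite IH /input mulmxN -[RHS]mulmxA /loop mulmxBl !mulmxA.
Qed.

Lemma stage_cost_qform K s (x : 'cV[R]_d) t : stage_cost A B Q Rc K s x t =
  qform (run_cost Q Rc (gain K) (s t)) (transition (loop A B (gain K)) s t *m x).
Proof.
rewrite /stage_cost state_transition /run_cost qformD qform_congr /input.
by congr (_ + _); rewrite /qform [(- _)^T]linearN/= mulmxN !mulNmx opprK.
Qed.

(** Stability is applied to the given chain: it charges every mode initially, so the
    mean of [|x_t|^2] dominates a positive multiple of each of the quadratic forms. *)
Lemma stabilizing_vanishing K : ms_stabilizing A B p K ->
  vanishing p (loop A B (gain K)).
Proof.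
move=> hK i x; set C := loop A B (gain K).
have one_psd : forall j : 'I_ns, psd (1%:M : 'M[R]_d).
  by move=> j y; rewrite qform1 sqnorm_ge0.
pose u t j := qform (iter t (lyap p C) (fun=> 1%:M) j) x.
have u0 t j : 0 <= u t j by exact: (iter_lyap_psd hp C t one_psd j x).
have E t : ('E_Pr[fun w => sqnorm (state A B K (omega ^~ w) x t)]
            = (\sum_j rho j * u t j)%:E)%E.
  have mx : @random_vector R d disp Om (fun=> x) by move=> a; exact: measurable_cst.
  rewrite unlock; under eq_integral do rewrite state_transition -qform1.
  rewrite (state_expectation homega C t mx (decoupled_cst homega x) one_psd).
  congr (_%:E); apply: eq_bigr => j _; congr (_ * _).
  by rewrite mulmxA mxtrace_mulC mulmxA /mxtrace big_ord1.
have Su : (fun t => \sum_j rho j * u t j) @ \oo --> (0 : R).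
  have := hK x rho disp Om Pr omega homega.
  by under eq_fun do rewrite E; move=> /fine_cvgP[_].
have Su' : (fun t => (rho i)^-1 * \sum_j rho j * u t j) @ \oo --> (0 : R).
  by rewrite -[0 in X in _ --> X](mulr0 (rho i)^-1); exact: cvgMl_tmp.
apply: squeeze_cvgr (cvg_cst 0) Su'; apply: nearW => t.
rewrite -/(u t i) u0/= mulrC ler_pdivlMr// (bigD1 i)//= mulrC lerDl.
by apply: sumr_ge0 => j _; rewrite mulr_ge0// ltW.
Qed.

Context (S : 'M[R]_d) (hS : forall N : 'M[R]_d, psd N -> 0 <= \tr (N *m S)).

Definition mean_value D : R := \sum_i rho i * \tr (D i *m S).

Lemma mean_value_mono D N : qle D N -> mean_value D <= mean_value N.
Proof.
move=> DN; apply: ler_sum => i _; apply: ler_wpM2l; first exact: ltW.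
rewrite -subr_ge0 -linearB/= -mulmxBl; apply: hS => x.
by rewrite qformB subr_ge0.
Qed.

Lemma mean_valueD D N : mean_value (fun i => D i + N i) = mean_value D + mean_value N.
Proof.
rewrite /mean_value -big_split/=; apply: eq_bigr => i _.
by rewrite mulmxDl linearD mulrDr.
Qed.

Lemma mean_valueZ c D : mean_value (fun i => c *: D i) = c * mean_value D.
Proof.
rewrite /mean_value mulr_sumr; apply: eq_bigr => i _.
by rewrite -scalemxAl linearZ/= mulrCA.
Qed.

Lemma mean_value_vanishing C D : vanishing p C ->
  (fun t => mean_value (iter t (lyap p C) D)) @ \oo --> (0 : R).
Proof.
move=> vC.
rewrite (_ : (fun t => _) = (fun t =>
  \sum_i \sum_a \sum_b rho i * S b a * iter t (lyap p C) D i a b)); last first.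
  apply/funext => t; apply: eq_bigr => i _; rewrite /mxtrace mulr_sumr.
  apply: eq_bigr => a _; rewrite mxE mulr_sumr; apply: eq_bigr => b _.
  by rewrite mulrA mulrAC.
have z : \sum_(i < ns) \sum_(a < d) \sum_(b < d) rho i * S b a * 0 = 0.
  by rewrite big1// => i _; rewrite big1// => a _; rewrite big1// => b _; rewrite mulr0.
rewrite -[0 in X in _ --> X]z.
apply: cvg_sumr => i; apply: cvg_sumr => a; apply: cvg_sumr => b.
by apply: cvgMl_tmp; exact: (vanishing_coef hp).
Qed.

Context (x0 : Om -> 'cV[R]_d) (hx0 : random_vector x0) (dx0 : decoupled Pr omega x0 S).

Let Vn K := value_iter p (loop A B (gain K)) (run_cost Q Rc (gain K)).

Lemma ecost_series K : ecost A B Q Rc Pr x0 omega K =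
  (\sum_(0 <= t <oo) (mean_value
     (iter t (lyap p (loop A B (gain K))) (run_cost Q Rc (gain K))))%:E)%E.
Proof.
have M_psd i : psd (run_cost Q Rc (gain K) i).
  by apply: posdef_psd; exact: run_cost_posdef.
rewrite /ecost integral_nneseries//.
- apply: eq_eseriesr => t _; rewrite -(state_expectation homega _ _ hx0 dx0)//.
  by apply: eq_integral => w _; rewrite stage_cost_qform.
- move=> t; apply/measurable_EFinP.
  under eq_fun do rewrite stage_cost_qform.
  exact: (measurable_qform_state homega).
- by move=> t w _; rewrite lee_fin stage_cost_qform; exact: M_psd.
Qed.

Lemma partial_cost K n :
  (\sum_(0 <= t < n) (mean_value
     (iter t (lyap p (loop A B (gain K))) (run_cost Q Rc (gain K))))%:E
   = (mean_value (Vn K n))%:E)%E.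
Proof.
rewrite sumEFin; congr (_%:E); elim: n => [|n IH].
  by rewrite big_geq// /mean_value big1// => i _; rewrite mul0mx linear0 mulr0.
rewrite big_nat_recr//= IH -mean_valueD; congr mean_value.
by apply/funext => i; rewrite -value_iterS_iter.
Qed.

Lemma mean_value_stage_ge0 K t : (0 <= (mean_value
  (iter t (lyap p (loop A B (gain K))) (run_cost Q Rc (gain K))))%:E)%E.
Proof.
rewrite lee_fin; apply: sumr_ge0 => i _; apply: mulr_ge0; first exact: ltW.
apply: hS; apply: (iter_lyap_psd hp) => j.
by apply: posdef_psd; exact: run_cost_posdef.
Qed.

Lemma ecost_ge0 K : (0 <= ecost A B Q Rc Pr x0 omega K)%E.
Proof. by rewrite ecost_series nneseries_ge0// => t _ _; exact: mean_value_stage_ge0. Qed.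

(** The bound serves for the policies one small gradient step away from a stabilizing
    one, with the cost-to-go of the latter as [P]. *)
Lemma ecost_upper K P G : (forall i, psd (P i)) -> (forall i, psd (G i)) ->
  qle (fun i => run_cost Q Rc (gain K) i + lyap p (loop A B (gain K)) P i + G i) P ->
  (ecost A B Q Rc Pr x0 omega K <= (mean_value P - mean_value G)%:E)%E.
Proof.
move=> P0 G0 MP; rewrite ecost_series; apply: lime_le.
  by apply: is_cvg_nneseries => t _ _; exact: mean_value_stage_ge0.
exists 1%N => // -[//|n] _ /=; rewrite partial_cost lee_fin lerBrDr -mean_valueD.
by apply: mean_value_mono; exact: (value_iter_upper hp).
Qed.

Lemma ecost_lower K P : vanishing p (loop A B (gain K)) ->
  qle P (fun i => run_cost Q Rc (gain K) i + lyap p (loop A B (gain K)) P i) ->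
  ((mean_value P)%:E <= ecost A B Q Rc Pr x0 omega K)%E.
Proof.
move=> vK MP.
have le_n n : ((mean_value P - mean_value (iter n (lyap p (loop A B (gain K))) P))%:E
    <= ecost A B Q Rc Pr x0 omega K)%E.
  apply: le_trans (_ : (mean_value (Vn K n))%:E <= _)%E.
    rewrite lee_fin lerBlDr -mean_valueD; apply: mean_value_mono.
    exact: (value_iter_lower hp).
  rewrite ecost_series -partial_cost; apply: nneseries_lim_ge => t _ _.
  exact: mean_value_stage_ge0.
move: le_n (ecost_ge0 K); case: (ecost _ _ _ _ _ _ _ _) => [r| |] // le_n _.
  2: by rewrite leey.
rewrite lee_fin -[leLHS]subr0.
have lim0 : (fun n => mean_value P - mean_value (iter n (lyap p (loop A B (gain K))) P))
    @ \oo --> mean_value P - 0.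
  by apply: cvgB; [exact: cvg_cst|exact: mean_value_vanishing].
apply: cvgr_to_le lim0 _.
by apply: nearW => n; rewrite -lee_fin.
Qed.

End cost.

(** * Stationary policies *)

(** A function that decreases at rate at least [c] along the ray from [K] in the
    direction [H] cannot have a zero gradient at [K]. *)
Lemma zero_gradient_rate (R : realType) m n (F : 'M[R]_(m, n) -> R)
    (K H : 'M[R]_(m, n)) (c e0 : R) : is_gradient F K 0 -> 0 < e0 ->
  (forall eps, 0 < eps <= e0 -> F (eps *: H + K) <= F K - eps * c) -> c <= 0.
Proof.
move=> [dF gF] e0_gt0 decr.
have dH : 'D_H F K = 0 by rewrite deriveE// gF mulmx0 linear0.
have cv : h^-1 *: (F (h *: H + K) - F K) @[h --> (0 : R)^'] --> (0 : R).
  have : derivable F K H by exact: diff_derivable.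
  by rewrite -[0 in X in _ --> X]dH; apply.
suff : 0 <= - c by rewrite oppr_ge0.
apply: cvgr_to_le (cvg_dnbhs_at_right cv) _.
near=> h; have h0 : 0 < h by near: h; exact: nbhs_right_gt.
have he : h <= e0 by near: h; exact: nbhs_right_le.
rewrite /GRing.scale/= mulrC ler_pdivrMr// mulNr mulrC.
by rewrite lerBlDl; apply: decr; rewrite h0.
Unshelve. all: by end_near. Qed.

Theorem mainTheorem2 (R : realType) (ns d k : nat)
  (A : 'I_ns -> 'M[R]_d) (B : 'I_ns -> 'M[R]_(d, k))
  (Q : 'I_ns -> 'M[R]_d) (Rc : 'I_ns -> 'M[R]_k)
  (hQ : forall i, posdef (Q i)) (hR : forall i, posdef (Rc i))
  (p : 'M[R]_ns) (hp : stochastic p)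
  (rho : 'I_ns -> R) (hrho : forall i, 0 < rho i)
  (disp : measure_display) (Om : measurableType disp) (Pr : probability Om R)
  (omega : nat -> Om -> 'I_ns) (homega : markov_chain p rho Pr omega)
  (x0 : Om -> 'cV[R]_d) (hx0 : random_vector x0)
  (hx0_fin : ('E_Pr[fun w => sqnorm (x0 w)] < +oo)%E)
  (hx0_indep : independent_of_chain Pr x0 omega)
  (hx0_pos : posdef (second_moment Pr x0))
  (P : 'I_ns -> 'M[R]_d) (hP : forall i, posdef (P i))
  (hPric : coupled_riccati A B Q Rc p P)
  (K : policy R ns d k) (hK : ms_stabilizing A B p K)
  (hgrad : is_gradient (cost A B Q Rc Pr x0 omega) K 0) :
  K = optimal_policy A B Rc p P /\
  (forall K' : policy R ns d k, ms_stabilizing A B p K' ->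
     (ecost A B Q Rc Pr x0 omega K <= ecost A B Q Rc Pr x0 omega K')%E).
Proof.
pose S := second_moment Pr x0.
have dx0 : decoupled Pr omega x0 S by exact: (decoupled_independent homega).
have hS (N : 'M[R]_d) : psd N -> 0 <= \tr (N *m S).
  move=> N0; rewrite -lee_fin -integral_qform//.
  by apply: integral_ge0 => w _; rewrite lee_fin; exact: N0.
have vanish (K' : policy R ns d k) : ms_stabilizing A B p K' ->
    vanishing p (loop A B (gain K')).
  exact: (stabilizing_vanishing hp hrho homega).
have upper := ecost_upper (A := A) (B := B) hQ hR hp hrho homega hS hx0 dx0.
have lower := ecost_lower (A := A) (B := B) hQ hR hp hrho homega hS hx0 dx0.
have vK := vanish _ hK.
have M_pos i : posdef (run_cost Q Rc (gain K) i) by exact: run_cost_posdef.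
(* V is the cost-to-go of the stationary policy. *)
have [V [fV sV]] := lyap_solution hp vK (fun i => (M_pos i).1).
have V_psd : forall i, psd (V i).
  apply: (lyap_comparison hp vK) => i x.
  by rewrite [in leRHS]fV qformD lerDr; exact: posdef_psd.
have V_pos i : posdef (V i).
  split; first exact: sV.
  move=> x x0'; rewrite fV qformD; apply: ltr_wpDr; last exact: (M_pos i).2.
  exact: lyap_psd.
have costK : ecost A B Q Rc Pr x0 omega K = (mean_value rho S V)%:E.
  apply/eqP; rewrite eq_le; apply/andP; split.
    have := upper K V (fun=> 0) V_psd.
    rewrite /mean_value [X in _ - X]big1 ?subr0; last first.
      by move=> i _; rewrite mul0mx linear0 mulr0.
    by apply => i x; rewrite ?qform0// addr0 -fV.
  by apply: lower => // i x; rewrite -fV.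
(* Move along - F and compare the decrease with the zero gradient. *)
pose F i := residual A B Rc p V (gain K) i.
pose H : policy R ns d k := @mxrow R ns (fun=> d) k F.
pose FF i := (F i)^T *m F i.
have FF_psd i : psd (FF i).
  by move=> x; rewrite /FF -[(F i)^T]mulmx1 qform_congr qform1 sqnorm_ge0.
have [e0 e0_gt0 step] := gradient_step hR sV fV.
have c_le0 : mean_value rho S FF <= 0.
  apply: (zero_gradient_rate (H := - H) hgrad e0_gt0) => eps he.
  have gainE : gain (eps *: - H + K) = fun i => gain K i + - eps *: F i.
    apply/funext => i; apply/matrixP => a b.
    rewrite /gain scalerN !mxE addrC; congr (_ + _); rewrite mulNr.
    by have /matrixP/(_ a b) := @mxrowK R ns (fun=> d) k F i; rewrite !mxE => ->.
  have := step eps he => /=; rewrite -/F -gainE => sle.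
  have eps0 : 0 <= eps by case/andP: he => /ltW.
  have epsFF_psd i : psd (eps *: FF i).
    by move=> x; rewrite qformZ mulr_ge0//; exact: FF_psd.
  have := upper (eps *: - H + K) V (fun i => eps *: FF i) V_psd epsFF_psd sle.
  rewrite mean_valueZ /cost costK /=.
  move: (ecost_ge0 A B hQ hR hp hrho homega hS hx0 dx0 (eps *: - H + K)).
  by case: (ecost _ _ _ _ _ _ _ (eps *: - H + K)) => [r| |].
(* The decrease rate is a sum over modes and rows of F; all its terms vanish. *)
have trFF i : \tr (FF i *m S) = \sum_a qform S (row a (F i))^T.
  rewrite /FF -mulmxA mxtrace_mulC; apply: eq_bigr => a _.
  rewrite /qform trmxK -!row_mul.
  by rewrite !mxE; apply: eq_bigr => b _; rewrite !mxE.
have F0 i : F i = 0.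
  have tr_ge0 j : 0 <= \tr (FF j *m S) by exact: hS.
  have tr0 : \tr (FF i *m S) = 0.
    apply/eqP; rewrite eq_le tr_ge0 andbT -(pmulr_rle0 _ (hrho i)).
    apply: le_trans c_le0; rewrite /mean_value (bigD1 i)//= lerDl.
    by apply: sumr_ge0 => j _; rewrite mulr_ge0// ltW.
  apply/row_matrixP => a; rewrite row0; apply/eqP/negPn/negP => rowF.
  have : (row a (F i))^T != 0.
    by apply/eqP => /(congr1 trmx); rewrite trmxK trmx0; exact/eqP.
  move=> /(hx0_pos.2); rewrite ltNge => /negP; apply.
  rewrite -tr0 trFF (bigD1 a)//= lerDl.
  by apply: sumr_ge0 => b _; exact: posdef_psd.
have bV : bellman A B Q Rc p V (gain K) by split.
have bP := riccati_bellman hR hp hP hPric.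
split.
  have gK := bellman_unique hQ hR hp bV bP.
  by rewrite -[LHS](@submxrowK R ns (fun=> d) k) -/(gain K) gK.
move=> K' hK'; rewrite costK; apply: lower; first exact: vanish.
exact: (bellman_improve hR hp _ bV).
Qed.
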